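(* For $n\ge1$, $\beta>0$ and $h\in\mathbb{R}$, let $\sigma=(\sigma_1,\dots,\sigma_n)\in\{-1,1\}^n$ have law \[ \mathbb{P}(\sigma)=Z^{-1}\exp\Bigl\{\frac{\beta}{n}\sum_{i<j}\sigma_i\sigma_j+h\sum_i\sigma_i\Bigr\}, \] with $Z$ the normalizing constant, let $W=\sum_{i=1}^n\sigma_i$, and let $\delta=\delta(n)=(1-(-1)^n)/2$. If $0<\beta<1$ and $h=0$, there is a constant $C$ depending only on $\beta$ such that for all $n$, \[ d_{\mathrm{loc}}\Bigl(\mathcal{L}\bigl(\tfrac{W+\delta}{2}\bigr),\mathrm{TP}\bigl(0,\tfrac{n}{4(1-\beta)}\bigr)\Bigr)\le Cn^{-3/4},\qquad d_{\mathrm{TV}}\Bigl(\mathcal{L}\bigl(\tfrac{W+\delta}{2}\bigr),\mathrm{TP}\bigl(0,\tfrac{n}{4(1-\beta)}\bigr)\Bigr)\le Cn^{-1/3}. \] If $0<\beta<1$ and $h\in\mathbb{R}$, and $m_0$ is the unique solution of $m=\tanh(\beta m+h)$, then as $n\to\infty$, \[ d_{\mathrm{loc}}\Bigl(\mathcal{L}\bigl(\tfrac{W+\delta}{2}\bigr),\mathrm{TP}\Bigl(\tfrac{nm_0}{2},\tfrac{n(1-m_0^2)}{4(1-\beta+\beta m_0^2)}\Bigr)\Bigr)=o(n^{-1/2}). \]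
   Context: For integer-supported laws with distribution functions $F,G$ (where $F(j)=\mathbb{P}[X\le j]$), $d_{\mathrm{loc}}(F,G)=\sup_{j\in\mathbb{Z}}|\Delta F(j)-\Delta G(j)|$ and $d_{\mathrm{TV}}(F,G)=\frac12\sum_{j\in\mathbb{Z}}|\Delta F(j)-\Delta G(j)|$, where $\Delta F(j)=F(j+1)-F(j)$. Translated Poisson: for $\mu\in\mathbb{R}$, $s^2>0$, $Z\sim\mathrm{TP}(\mu,s^2)$ means $Z-\lfloor\mu-s^2\rfloor\sim\mathrm{Po}(s^2+\gamma)$ with $\gamma=\mu-s^2-\lfloor\mu-s^2\rfloor$. Note $(W+\delta)/2$ is integer valued. *)

(* Defs.v *)
From HB Require Import structures.
From mathcomp Require Import all_boot all_order all_algebra.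
From mathcomp Require Import all_classical all_reals all_analysis.
Set Implicit Arguments. Unset Strict Implicit. Unset Printing Implicit Defensive.
Import Order.TTheory GRing.Theory Num.Theory.
Local Open Scope ring_scope.

Definition spin {R : pzRingType} (b : bool) : R := if b then 1 else -1.

Definition config (n : nat) := {ffun 'I_n -> bool}.

Definition magnet {R : realType} (n : nat) (s : config n) : R :=
  \sum_(i < n) spin (s i).

Definition cw_energy {R : realType} (n : nat) (beta h : R) (s : config n) : R :=
  beta / n%:R * (\sum_(i < n) \sum_(j < n | (i < j)%N) spin (s i) * spin (s j))
  + h * \sum_(i < n) spin (s i).

Definition cw_weight {R : realType} (n : nat) (beta h : R) (s : config n) : R :=
  expR (cw_energy beta h s).

Definition cw_Z {R : realType} (n : nat) (beta h : R) : R :=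
  \sum_(s : config n) cw_weight beta h s.

Definition delta {R : realType} (n : nat) : R := (1 - (-1) ^+ n) / 2.

Definition law_shifted {R : realType} (n : nat) (beta h : R) (k : int) : R :=
  (\sum_(s : config n | magnet (R:=R) s + delta n == 2 * k%:~R) cw_weight beta h s)
  / cw_Z n beta h.

Definition poisson_pmf {R : realType} (lam : R) (k : nat) : R :=
  expR (- lam) * lam ^+ k / (k`!)%:R.

(* Translated Poisson TP(mu, s2): Z - floor(mu - s2) ~ Po(s2 + gamma),
   gamma = mu - s2 - floor(mu - s2) *)
Definition TP_pmf {R : realType} (mu s2 : R) (j : int) : R :=
  let a := Num.floor (mu - s2) in
  let gam := mu - s2 - a%:~R in
  if (0 <= j - a)%R then poisson_pmf (s2 + gam) `|j - a|%N else 0.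

Definition dloc {R : realType} (p q : int -> R) : \bar R :=
  ereal_sup [set (`|p j - q j|)%:E | j in [set: int]].

Definition dTV {R : realType} (p q : int -> R) : \bar R :=
  ((2 : R)^-1)%:E * (\esum_(j in [set: int]) (`|p j - q j|)%:E).

Definition tanh {R : realType} (x : R) : R :=
  (expR x - expR (- x)) / (expR x + expR (- x)).

(* Main.v *)
Require Import Defs.
From HB Require Import structures.
From mathcomp Require Import all_boot all_order all_algebra.
From mathcomp Require Import all_classical all_reals all_analysis.
From mathcomp Require Import ring lra zify.
Import Order.TTheory GRing.Theory Num.Theory numFieldNormedType.Exports.
Local Open Scope ring_scope.

(** Stein's method for a single atom. Let K be the number of plus spins and P its law, so that
    (W + delta)/2 = K - floor(n/2). The detailed-balance relation between P(K) and P(K+1), tested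
    against W - n m0, gives E (W - n m0)^2 = O(n), because tanh is 1-Lipschitz and beta < 1. The
    Stein equation of the Poisson law q with parameter lam, for the singleton {i}, has a solution
    bounded by 1/lam, by log-concavity of q; hence |P(i) - q(i)| is at most
    E |1 - (P(K+1)/P(K)) (k+1)/lam| up to the mass of P outside |x| <= e n, where
    x = K - n(1 + m0)/2 and k is K translated to the Poisson index. The variance of the translated
    Poisson law is exactly what cancels the first-order term of that ratio, which is therefore
    1 + O((x^2 + n)/n^2), and the second moment turns this into a local distance O(1/n), for every
    field h. Splitting the total variation sum at |x| = n^(2/3), with this bound inside and
    Chebyshev's inequality outside, gives O(n^(-1/3)). *)

(** * Law of the number of plus spins *)

Lemma sum_config_card (R : realType) (n : nat) (F : nat -> R) :
  \sum_(s : config n) F #|[set i | s i]| = \sum_(K < n.+1) 'C(n, K)%:R * F K.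
Proof.
rewrite (reindex (fun A : {set 'I_n} => [ffun i => i \in A] : config n)) /=; last first.
  exists (fun s : config n => [set i | s i]) => [A _|s _].
    by apply/setP => i; rewrite inE ffunE.
  by apply/ffunP => i; rewrite ffunE inE.
transitivity (\sum_(A : {set 'I_n}) F #|A|).
  by apply: eq_bigr => A _; congr (F #|pred_of_set _|); apply/setP => i; rewrite inE ffunE.
rewrite (partition_big (fun A : {set 'I_n} => inord #|A| : 'I_n.+1) xpredT) //=.
apply: eq_bigr => K _.
have cA (A : {set 'I_n}) : (inord #|A| == K :> 'I_n.+1) = (#|A| == K :> nat).
  by rewrite -val_eqE /= inordK // ltnS -[leqRHS]card_ord max_card.
under eq_bigl do rewrite cA.
rewrite (eq_bigr (fun=> F K)) => [|A /eqP ->//].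
rewrite sumr_const -[LHS]mulr_natl; congr (1 *+ _ * _).
have := card_draws 'I_n K; rewrite card_ord => <-.
by apply: eq_card => A; rewrite inE.
Qed.

Lemma magnet_card (R : realType) (n : nat) (s : config n) :
  magnet s = 2 * #|[set i | s i]|%:R - n%:R :> R.
Proof.
rewrite /magnet (eq_bigr (fun i => 2 * (s i)%:R - 1 : R)); last first.
  by move=> i _; rewrite /spin; case: (s i) => /=; ring.
rewrite sumrB -mulr_sumr sumr_const card_ord; congr (2 * _ - _).
rewrite -sum1_card natr_sum [RHS]big_mkcond /=.
by apply: eq_bigr => i _; rewrite inE; case: (s i).
Qed.

(** Spins square to one, so [magnet s ^+ 2] is [n] plus twice the sum over pairs; the energy depends
    on the configuration only through the magnetization. *)
Lemma cw_energyE (R : realType) (n : nat) (beta h : R) (s : config n) :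
  cw_energy beta h s =
  beta / n%:R * ((magnet s ^+ 2 - n%:R) / 2) + h * magnet s :> R.
Proof.
rewrite /cw_energy; congr (_ * _ + _).
pose a := fun i => spin (s i) : R.
have sq i : a i * a i = 1 by rewrite /a /spin; case: (s i); ring.
have E1 : magnet s ^+ 2 = \sum_(i < n) \sum_(j < n) a i * a j.
  by rewrite expr2 /magnet mulr_suml; apply: eq_bigr => i _; rewrite mulr_sumr.
have E2 : \sum_(i < n) \sum_(j < n | (j < i)%N) a i * a j =
          \sum_(i < n) \sum_(j < n | (i < j)%N) a i * a j.
  rewrite (exchange_big_dep xpredT) //=; apply: eq_bigr => i _.
  by apply: eq_bigr => j _; rewrite mulrC.
have E3 : magnet s ^+ 2 =
   (\sum_(i < n) \sum_(j < n | (i < j)%N) a i * a j) *+ 2 + n%:R.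
  rewrite E1 mulr2n -{1}E2 -!big_split /= -[n in n%:R]card_ord -sumr_const -big_split /=.
  apply: eq_bigr => i _.
  rewrite (bigD1 i) //= sq addrC; congr (_ + _).
  rewrite (bigID (fun j : 'I_n => (j < i)%N)) /=; congr (_ + _); apply: eq_bigl => j.
    by rewrite -val_eqE /=; case: ltngtP.
  by rewrite -val_eqE /=; case: ltngtP.
rewrite E3 -[LHS]/(\sum_(i < n) \sum_(j < n | (i < j)%N) a i * a j); lra.
Qed.

Definition cw_exponent {R : realType} (n : nat) (beta h : R) (K : nat) : R :=
  beta / n%:R * (((2 * K%:R - n%:R) ^+ 2 - n%:R) / 2) + h * (2 * K%:R - n%:R).

(* The probability of exactly [K] plus spins, that is, of [W = 2 K - n]. *)
Definition cw_plus {R : realType} (n : nat) (beta h : R) (K : nat) : R :=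
  'C(n, K)%:R * expR (cw_exponent n beta h K) / cw_Z n beta h.

Lemma cw_weightE (R : realType) (n : nat) (beta h : R) (s : config n) :
  cw_weight beta h s = expR (cw_exponent n beta h #|[set i | s i]|).
Proof. by rewrite /cw_weight cw_energyE magnet_card. Qed.

Lemma cw_Z_gt0 (R : realType) (n : nat) (beta h : R) : 0 < cw_Z n beta h.
Proof.
rewrite /cw_Z (bigD1 [ffun=> true]) //=.
by rewrite ltr_wpDr ?expR_gt0// sumr_ge0// => *; exact: expR_ge0.
Qed.

Lemma cw_plus_ge0 (R : realType) (n : nat) (beta h : R) (K : nat) :
  0 <= cw_plus n beta h K.
Proof. by rewrite divr_ge0 ?mulr_ge0 ?expR_ge0 // ltW // cw_Z_gt0. Qed.

Lemma cw_plus_gtn (R : realType) (n : nat) (beta h : R) (K : nat) :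
  (n < K)%N -> cw_plus n beta h K = 0.
Proof. by move=> nK; rewrite /cw_plus bin_small // !mul0r. Qed.

Lemma sum_cw_plus (R : realType) (n : nat) (beta h : R) :
  \sum_(K < n.+1) cw_plus n beta h K = 1.
Proof.
rewrite -mulr_suml -(sum_config_card R n (fun K => expR (cw_exponent n beta h K))).
under eq_bigr do rewrite -cw_weightE.
by rewrite divff // gt_eqF // cw_Z_gt0.
Qed.

Lemma delta_half (R : realType) (n : nat) : delta n = n%:R - 2 * n./2%:R :> R.
Proof.
have -> : n%:R = (odd n)%:R + 2 * n./2%:R :> R.
  by rewrite -{1}(odd_double_half n) natrD -mul2n natrM.
by rewrite /delta -signr_odd; case: (odd n); rewrite ?expr1 ?expr0 /=; lra.
Qed.

Lemma law_shifted_natB (R : realType) (n K : nat) (beta h : R) :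
  law_shifted n beta h (K%:Z - n./2%:Z) = cw_plus n beta h K.
Proof.
have mE (s : config n) : (magnet (R:=R) s + delta n == 2 * (K%:Z - n./2%:Z)%:~R)
    = (#|[set i | s i]| == K).
  rewrite magnet_card delta_half rmorphB /= -!pmulrn.
  rewrite -[RHS](eqr_nat R); apply/eqP/eqP; lra.
rewrite /law_shifted /cw_plus; congr (_ / _).
under eq_bigl do rewrite mE.
rewrite big_mkcond /=.
under eq_bigr => s _ do rewrite -mulrb -mulr_natl cw_weightE.
rewrite (sum_config_card R n (fun L => (L == K)%:R * expR (cw_exponent n beta h L))).
case: (ltnP n K) => nK.
  rewrite bin_small // mul0r big1 // => i _.
  by rewrite (_ : (i == K :> nat) = false) ?mul0r ?mulr0 //; have := ltn_ord i; lia.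
rewrite (bigD1 (Ordinal (nK : (K < n.+1)%N))) //= eqxx mul1r big1 ?addr0 // => i.
by rewrite -val_eqE /= => /negbTE ->; rewrite mul0r mulr0.
Qed.

(** Such a [j] would require a negative number of plus spins. Together with [law_shifted_natB] this
    covers every integer. *)
Lemma law_shifted_lt (R : realType) (n : nat) (beta h : R) (j : int) :
  j + n./2%:Z < 0 -> law_shifted n beta h j = 0.
Proof.
move=> j0; rewrite /law_shifted big_pred0 ?mul0r // => s.
rewrite magnet_card delta_half; apply/negbTE/eqP => E.
have : (#|[set i | s i]|%:Z)%:~R = (j + n./2%:Z)%:~R :> R.
  by rewrite rmorphD /= -!pmulrn; lra.
by move/intr_inj => E'; move: j0; rewrite -E'.
Qed.

(** * Second moment of the magnetization *)

(** Equivalent to tanh(w/2) <= w/2. The function [f] starts at 2 and has derivative (1 - x) e^x - 1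
    <= 0. *)
Lemma expR_pade_le (R : realType) (w : R) : 0 <= w -> (2 - w) * expR w <= 2 + w.
Proof.
rewrite le_eqVlt => /orP[/eqP <-|w0]; first by rewrite expR0; lra.
pose f (x : R) := (2 - x) * expR x - x.
have df (x : R) : is_derive x (1 : R) f ((1 - x) * expR x - 1).
  rewrite /f; apply: is_derive_eq.
  rewrite /GRing.scale /=; ring.
have cf : {within `[0, w], continuous f}%classic.
  by apply: derivable_within_continuous => x _; have [] := df x.
have [c] := MVT w0 (fun x _ => df x) cf; rewrite in_itv /= => /andP[c0 _].
have : (1 - c) * expR c <= 1.
  by rewrite -ler_pdivlMr ?expR_gt0 // div1r -expRN; exact: expR_ge1Dx.
rewrite subr0 /f expR0 subr0 mulr1 subr0 => hc; nra.
Qed.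

Lemma cosh2_gt0 (R : realType) (x : R) : 0 < expR x + expR (- x).
Proof. by rewrite addr_gt0 ?expR_gt0. Qed.

Lemma tanhN (R : realType) (x : R) : tanh (- x) = - tanh x.
Proof. by rewrite /tanh opprK -mulNr opprB [expR (- x) + expR x]addrC. Qed.

Lemma tanh_ltr1 (R : realType) (x : R) : tanh x < 1.
Proof.
rewrite /tanh ltr_pdivrMr ?cosh2_gt0 // mul1r.
by have := expR_gt0 (- x); lra.
Qed.

Lemma tanh_gtrN1 (R : realType) (x : R) : -1 < tanh x.
Proof. by have := tanh_ltr1 R (- x); rewrite tanhN; lra. Qed.

Lemma expR_tanh (R : realType) (x : R) : expR (2 * x) * (1 - tanh x) = 1 + tanh x.
Proof.
rewrite mulr_natl mulr2n expRD /tanh expRN.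
have := expR_gt0 x; set a := expR x => a0.
have a2 : a ^+ 2 + 1 != 0 by rewrite gt_eqF // ltr_pwDr // sqr_ge0.
by field; rewrite gt_eqF //= -expr2 a2.
Qed.

(** With e = e^v and f = e^w the increment is 2 e^2 (f^2 - 1) over a denominator that exceeds e^2 (f
    + 1)^2 by the square of e^2 f - 1; what remains, 2 (f - 1) <= w (f + 1), is [expR_pade_le]. *)
Lemma tanh_lipschitz_pos (R : realType) (v w : R) : 0 <= w -> tanh (v + w) - tanh v <= w.
Proof.
move=> w0; have H := expR_pade_le R w w0.
have F0 := expR_gt0 w; have E0 := expR_gt0 v.
rewrite /tanh !opprD !expRD !expRN.
set e := expR v in E0 *; set f := expR w in F0 H *.
have -> : (e * f - e^-1 * f^-1) / (e * f + e^-1 * f^-1) - (e - e^-1) / (e + e^-1)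
        = 2 * e ^+ 2 * (f ^+ 2 - 1) / ((e ^+ 2 * f ^+ 2 + 1) * (e ^+ 2 + 1)).
  field; rewrite !gt_eqF //=; nra.
rewrite ler_pdivrMr; last by nra.
have sq : 0 <= (e ^+ 2 * f - 1) ^+ 2 by exact: sqr_ge0.
have e2 : 0 < e ^+ 2 by rewrite exprn_gt0.
have A1 : e ^+ 2 * (f + 1) ^+ 2 <= (e ^+ 2 * f ^+ 2 + 1) * (e ^+ 2 + 1).
  rewrite -subr_ge0; apply: le_trans sq _; rewrite le_eqVlt; apply/orP; left; apply/eqP; ring.
apply: le_trans (ler_wpM2l w0 A1).
have -> : w * (e ^+ 2 * (f + 1) ^+ 2) = e ^+ 2 * (f + 1) * (w * (f + 1)) by ring.
have -> : 2 * e ^+ 2 * (f ^+ 2 - 1) = e ^+ 2 * (f + 1) * (2 * (f - 1)) by ring.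
by rewrite ler_wpM2l //; nra.
Qed.

(** The factor [w] makes the estimate independent of its sign: a negative increment is the positive
    case started from [v + w]. *)
Lemma tanh_lipschitz (R : realType) (v w : R) : w * (tanh (v + w) - tanh v) <= w ^+ 2.
Proof.
rewrite expr2; have [w0|w0] := leP 0 w.
  by rewrite ler_wpM2l // tanh_lipschitz_pos.
rewrite ler_nM2l //.
have /(tanh_lipschitz_pos R (v + w)) : 0 <= - w by lra.
by rewrite addrK; lra.
Qed.

(** The binomial coefficients have ratio (n - K) / (K + 1), and the exponent grows by [2 * u]. The
    form without division stays valid for K >= n, where both sides vanish. *)
Lemma cw_plusS (R : realType) (n K : nat) (beta h : R) : (0 < n)%N ->
  cw_plus n beta h K.+1 * K.+1%:R = cw_plus n beta h K * (n%:R - K%:R) *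
    expR (2 * (beta * (2 * K%:R - n%:R + 1) / n%:R + h)).
Proof.
move=> n0; have nR : n%:R != 0 :> R by rewrite pnatr_eq0 -lt0n.
set u := beta * _ / _ + h.
have [Kn|nK] := leqP K n; last by rewrite !cw_plus_gtn ?mul0r // ltnW.
rewrite /cw_plus.
have -> : cw_exponent n beta h K.+1 = cw_exponent n beta h K + 2 * u.
  by rewrite /cw_exponent /u -natr1; field.
rewrite expRD.
have := congr1 (fun k => k%:R : R) (mul_bin_left n K); rewrite /= !natrM natrB // => E.
transitivity (K.+1%:R * 'C(n, K.+1)%:R *
  (expR (cw_exponent n beta h K) * expR (2 * u) / cw_Z n beta h)); first by ring.
by rewrite E; ring.
Qed.

(** Detailed balance for single spin flips: since e^(2u) = (1 + tanh u) / (1 - tanh u), each of the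
    n - K minus spins flips at rate 1 + tanh u, and each of the K + 1 plus spins flips back at rate
    1 - tanh u. *)
Lemma cw_plus_balance (R : realType) (n K : nat) (beta h : R)
    (u := beta * (2 * K%:R - n%:R + 1) / n%:R + h) :
  (0 < n)%N ->
  cw_plus n beta h K * (n%:R - K%:R) * (1 + tanh u) =
  cw_plus n beta h K.+1 * K.+1%:R * (1 - tanh u).
Proof. by move=> n0; rewrite cw_plusS // -/u -expR_tanh mulrA. Qed.

(* [A = n - W], [B = n + W], [y = W - n m0]; [tp] and [tm] are the increments of [tanh] from
   [beta m0 + h] after a spin flip up or down. *)
Lemma cw_drift (R : realType) (beta m0 n A B y tp tm : R) :
  0 < beta < 1 -> -1 < m0 < 1 -> 0 < n -> 0 <= A -> 0 <= B ->
  A = n * (1 - m0) - y -> B = n * (1 + m0) + y ->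
  tp * (y + 1) <= beta * (y + 1) ^+ 2 / n -> tm * (y - 1) <= beta * (y - 1) ^+ 2 / n ->
  A * (1 + (m0 + tp)) * (y + 1) - B * (1 - (m0 + tm)) * (y - 1) <=
  2 * n + 2 + 9 / (1 - beta) - (1 - beta) * y ^+ 2.
Proof.
move=> b01 m01 n0 A0 B0 EA EB Hp Hm.
have n_neq0 : n != 0 by rewrite gt_eqF.
have {}Hp := ler_wpM2l A0 Hp; have {}Hm := ler_wpM2l B0 Hm.
have E : A * (beta * (y + 1) ^+ 2 / n) + B * (beta * (y - 1) ^+ 2 / n) =
   2 * beta * (y ^+ 2 + 1) - 2 * beta * (B - A) / n * y by rewrite EA EB; field.
have HW : `|(B - A) / n| <= 2.
  by rewrite normrM normfV (gtr0_norm n0) ler_pdivrMr // ler_norml; lra.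
have HW' : - (2 * beta * (B - A) / n * y) <= 4 * `|y|.
  apply: le_trans (ler_norm _) _; rewrite normrN normrM.
  have -> : 2 * beta * (B - A) / n = 2 * beta * ((B - A) / n) by field.
  rewrite ler_wpM2r // normrM ger0_norm; last by lra.
  nra.
have Hmy : - (2 * m0 * y) <= 2 * `|y|.
  apply: le_trans (ler_norm _) _; rewrite normrN normrM ler_wpM2r //.
  by rewrite ler_norml; lra.
(* The quadratic terms leave -2 (1 - beta) y^2; by completing a square, half of it absorbs the
   linear terms 4 |y| + 2 |y|. *)
have HS : 6 * `|y| <= (1 - beta) * y ^+ 2 + 9 / (1 - beta).
  have b1 : 0 < 1 - beta by lra.
  rewrite -subr_ge0 -[y ^+ 2]real_normK ?num_real //.
  have -> : (1 - beta) * `|y| ^+ 2 + 9 / (1 - beta) - 6 * `|y|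
     = ((1 - beta) * `|y| - 3) ^+ 2 / (1 - beta) by field; rewrite gt_eqF.
  by rewrite divr_ge0 ?sqr_ge0 // ltW.
have EE : A * (1 + (m0 + tp)) * (y + 1) - B * (1 - (m0 + tm)) * (y - 1) =
  A * (tp * (y + 1)) + B * (tm * (y - 1)) - 2 * y ^+ 2 + 2 * n * (1 - m0 ^+ 2) - 2 * m0 * y.
  by rewrite EA EB; ring.
have m2 : n * (1 - m0 ^+ 2) <= n by have := mulr_ge0 (ltW n0) (sqr_ge0 m0); nra.
by nra.
Qed.

(** Detailed balance makes the mean of the left side of [cw_drift] zero, while the right side is of
    order [n] minus (1 - beta) y^2; taking means bounds the mean of y^2. *)
Lemma cw_second_moment (R : realType) (beta h m0 : R) (n : nat) :
  0 < beta < 1 -> m0 = tanh (beta * m0 + h) -> (0 < n)%N ->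
  \sum_(K < n.+1) cw_plus n beta h K * (2 * K%:R - n%:R - n%:R * m0) ^+ 2
   <= (4 + 9 / (1 - beta)) / (1 - beta) * n%:R.
Proof.
move=> b01 m0E n_gt0; have nR : 0 < n%:R :> R by rewrite ltr0n.
have n1 : 1 <= n%:R :> R by rewrite ler1n.
have m01 : -1 < m0 < 1 by rewrite m0E tanh_gtrN1 tanh_ltr1.
have b1 : 0 < 1 - beta by lra.
pose P := cw_plus n beta h.
pose y K : R := 2 * K%:R - n%:R - n%:R * m0.
pose t (z : R) := tanh (beta * m0 + h + beta * z / n%:R).
have balance K : P K * (n%:R - K%:R) * (1 + t (y K + 1)) = P K.+1 * K.+1%:R * (1 - t (y K.+1 - 1)).
  have := @cw_plus_balance R n K beta h n_gt0.
  have -> : beta * (2 * K%:R - n%:R + 1) / n%:R + h = beta * m0 + h + beta * (y K + 1) / n%:R.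
    by rewrite /y; field; rewrite gt_eqF.
  have -> // : y K.+1 - 1 = y K + 1 by rewrite /y -natr1; ring.
have tE z : (t z - m0) * z <= beta * z ^+ 2 / n%:R.
  have := @tanh_lipschitz R (beta * m0 + h) (beta * z / n%:R).
  rewrite -m0E -/(t z) => H.
  have bn : 0 < beta / n%:R by rewrite divr_gt0 //; lra.
  rewrite -(ler_pM2l bn); apply: le_trans (le_trans H _).
    by rewrite le_eqVlt; apply/orP; left; apply/eqP; ring.
  by rewrite le_eqVlt; apply/orP; left; apply/eqP; ring.
(* Balance is tested against the midpoint deviation [y K + 1], which equals [y K.+1 - 1]. The index
   shift costs nothing: the term K = n on the left and the term K = 0 on the right vanish. *)
have S0 : \sum_(K < n.+1) P K * (n%:R - K%:R) * (1 + t (y K + 1)) * (y K + 1) =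
          \sum_(K < n.+1) P K * K%:R * (1 - t (y K - 1)) * (y K - 1).
  rewrite big_ord_recr big_ord_recl /= subrr !mulr0 !mul0r addr0 add0r.
  apply: eq_bigr => K _; rewrite balance /bump /= add1n.
  by congr (_ * _); rewrite /y -natr1; ring.
pose c := 2 * n%:R + 2 + 9 / (1 - beta).
have S1 : 0 <= \sum_(K < n.+1) P K * (c - (1 - beta) * y K ^+ 2).
  have D : 2 * \sum_(K < n.+1) P K * (n%:R - K%:R) * (1 + t (y K + 1)) * (y K + 1) -
     2 * \sum_(K < n.+1) P K * K%:R * (1 - t (y K - 1)) * (y K - 1) = 0.
    by rewrite S0 subrr.
  rewrite -[leLHS]D !mulr_sumr -sumrB; apply: ler_sum => K _.
  have Kn : K%:R <= n%:R :> R by rewrite ler_nat -ltnS.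
  have K0 : 0 <= K%:R :> R by [].
  have A0 : 0 <= 2 * (n%:R - K%:R) :> R by lra.
  have B0 : 0 <= 2 * K%:R :> R by lra.
  have EA : 2 * (n%:R - K%:R) = n%:R * (1 - m0) - y K by rewrite /y; ring.
  have EB : 2 * K%:R = n%:R * (1 + m0) + y K by rewrite /y; ring.
  have H := cw_drift R beta m0 n%:R _ _ (y K) _ _ b01 m01 nR A0 B0 EA EB (tE _) (tE _).
  apply: le_trans (ler_wpM2l (cw_plus_ge0 R n beta h K) H).
  by rewrite le_eqVlt; apply/orP; left; apply/eqP; rewrite /P; ring.
have S2 : \sum_(K < n.+1) P K * (c - (1 - beta) * y K ^+ 2) =
     c - (1 - beta) * \sum_(K < n.+1) P K * y K ^+ 2.
  rewrite -[c in RHS]mul1r -(sum_cw_plus R n beta h) mulr_suml mulr_sumr -sumrB.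
  by apply: eq_bigr => K _; rewrite /P; ring.
have H : (1 - beta) * \sum_(K < n.+1) P K * y K ^+ 2 <= c by rewrite -subr_ge0 -S2.
rewrite mulrAC ler_pdivlMr // mulrC; apply: le_trans H _.
have g9 : 0 <= 9 / (1 - beta) by rewrite divr_ge0 // ltW.
by rewrite /c; nra.
Qed.

(** * Stein equation for the Poisson law *)

(* The library has a [poisson_pmf] of its own, which shadows the one of [Defs]. *)
Local Notation pois := Defs.poisson_pmf.

Lemma poisson_gt0 (R : realType) (lam : R) (k : nat) : 0 < lam -> 0 < pois lam k.
Proof.
by move=> l0; rewrite /pois divr_gt0 ?mulr_gt0 ?expR_gt0 ?exprn_gt0 // ltr0n fact_gt0.
Qed.

Lemma poisson_recS (R : realType) (lam : R) (k : nat) :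
  pois lam k.+1 * k.+1%:R = lam * pois lam k.
Proof.
rewrite /pois factS natrM exprS.
have k1 : k.+1%:R != 0 :> R by rewrite pnatr_eq0.
have k2 : (k`!)%:R != 0 :> R by rewrite pnatr_eq0 -lt0n fact_gt0.
by field; rewrite k2 nat1r k1.
Qed.

Lemma poisson_series_cvg (R : realType) (lam : R) :
  (series (pois lam) @ \oo --> (1 : R))%classic.
Proof.
have -> : series (pois lam) = (fun N => expR (- lam) * series (exp_coeff lam) N).
  apply/funext => N; rewrite /series /= mulr_sumr.
  by apply: eq_bigr => k _; rewrite /pois /exp_coeff /= mulrA.
rewrite -(expR0 R) -(addNr lam) expRD.
by apply: cvgM; [exact: cvg_cst | exact: is_cvg_series_exp_coeff].
Qed.

Lemma poisson_sum_le1 (R : realType) (lam : R) (N : nat) : 0 < lam ->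
  \sum_(0 <= k < N) pois lam k <= 1.
Proof.
move=> l0; have c := poisson_series_cvg R lam.
have nd : nondecreasing_seq (series (pois lam)).
  by apply: nondecreasing_series => k _ _; rewrite ltW // poisson_gt0.
by have := nondecreasing_cvgn_le nd (cvgP _ c) N; rewrite (cvg_lim _ c).
Qed.

Lemma poisson_sum_range_le1 (R : realType) (lam : R) (M N : nat) : 0 < lam ->
  \sum_(M <= k < N) pois lam k <= 1.
Proof.
move=> l0; apply: le_trans (poisson_sum_le1 R lam N l0).
have [MN|NM] := leqP M N; last first.
  by rewrite big_geq ?sumr_ge0 // 1?ltnW // => k _; rewrite ltW // poisson_gt0.
rewrite (big_cat_nat (leq0n M) MN) //= lerDr sumr_ge0 // => k _.
by rewrite ltW // poisson_gt0.
Qed.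

Lemma fact_log_convex (l a b : nat) : ((l + a)`! * (l + b)`! <= l`! * (l + a + b)`!)%N.
Proof.
elim: b => [|b IH]; first by rewrite !addn0 mulnC.
rewrite !addnS !factS mulnCA [leqRHS]mulnCA.
by apply: leq_mul => //; rewrite ltnS -addnA leq_add2l leq_addl.
Qed.

(** Both products have the same index sum, hence the same power of [lam]; moving the two indices
    inward can only decrease the product of factorials. *)
Lemma poisson_log_concave (R : realType) (lam : R) (l k i : nat) : 0 < lam ->
  (l <= k)%N -> (k <= i)%N -> pois lam l * pois lam i <= pois lam k * pois lam (i - k + l).
Proof.
move=> l0 lk ki.
have [a ak] : exists a, k = (l + a)%N by exists (k - l)%N; rewrite subnKC.
have [b bi] : exists b, i = (k + b)%N by exists (i - k)%N; rewrite subnKC.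
rewrite bi ak addKn (addnC b) /pois.
have -> : expR (- lam) * lam ^+ l / l`!%:R *
    (expR (- lam) * lam ^+ (l + a + b) / (l + a + b)`!%:R) =
  expR (- lam) ^+ 2 * lam ^+ (l + l + a + b) / (l`! * (l + a + b)`!)%:R.
  by rewrite natrM invfM !exprD; ring.
have -> : expR (- lam) * lam ^+ (l + a) / (l + a)`!%:R *
    (expR (- lam) * lam ^+ (l + b) / (l + b)`!%:R) =
  expR (- lam) ^+ 2 * lam ^+ (l + l + a + b) / ((l + a)`! * (l + b)`!)%:R.
  by rewrite natrM invfM !exprD; ring.
apply: ler_wpM2l; first by rewrite mulr_ge0 ?exprn_ge0 ?expR_ge0 // ltW.
by rewrite lef_pV2 ?posrE ?ltr0n ?muln_gt0 ?fact_gt0 // ler_nat fact_log_convex.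
Qed.

(** Log-concavity trades each product q(i) q(l) for q(k) q(l + i - k), and the shifted masses sum to
    at most 1. *)
Lemma poisson_cdf_ratio (R : realType) (lam : R) (k i : nat) : 0 < lam -> (k <= i)%N ->
  pois lam i * \sum_(0 <= l < k.+1) pois lam l <= pois lam k.
Proof.
move=> l0 ki; rewrite mulr_sumr.
apply: (@le_trans _ _ (\sum_(0 <= l < k.+1) pois lam k * pois lam (l + (i - k)))).
  rewrite !big_mkord; apply: ler_sum => l _.
  by rewrite mulrC addnC poisson_log_concave // -ltnS.
rewrite -mulr_sumr -[leRHS]mulr1 ler_wpM2l ?(ltW (poisson_gt0 _ _ _ _)) //.
have := poisson_sum_range_le1 R lam (0 + (i - k)) (k.+1 + (i - k)) l0.
by rewrite big_addn addnK.
Qed.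

(** Mirror image of [poisson_cdf_ratio]: the masses beyond [k] are shifted down by k - i. *)
Lemma poisson_tail_ratio (R : realType) (lam : R) (k i : nat) : 0 < lam -> (i <= k)%N ->
  pois lam i * (1 - \sum_(0 <= l < k.+1) pois lam l) <= pois lam k.
Proof.
move=> l0 ik; set F := \sum_(0 <= l < k.+1) _.
have qi0 := poisson_gt0 R lam i l0; have qk0 := poisson_gt0 R lam k l0.
suff H : 1 <= F + pois lam k / pois lam i.
  by rewrite mulrC -ler_pdivlMr //; lra.
(* The tail is infinite, so the total mass 1 is replaced by the limit of the partial sums, each of
   which is bounded. *)
rewrite -(cvg_lim _ (poisson_series_cvg R lam)) //.
apply: limr_le; first exact: cvgP (poisson_series_cvg R lam).
exists k.+1 => // N /= kN; rewrite /series /=.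
rewrite (big_cat_nat (leq0n k.+1) kN) //= lerD2l ler_pdivlMr // mulrC mulr_sumr.
apply: (@le_trans _ _ (\sum_(k.+1 <= l < N) pois lam k * pois lam (l - (k - i)))).
  rewrite big_nat_cond [leRHS]big_nat_cond; apply: ler_sum => l /andP[/andP[kl _] _].
  apply: le_trans (poisson_log_concave R lam i k l l0 ik (ltnW kl)) _.
  by rewrite (_ : (l - k + i = l - (k - i))%N) //; lia.
rewrite -mulr_sumr -[leRHS]mulr1 ler_wpM2l ?(ltW qk0) //.
have := poisson_sum_range_le1 R lam (k.+1 - (k - i)) (N - (k - i)) l0.
apply: le_trans; rewrite le_eqVlt; apply/orP; left; apply/eqP.
rewrite -[X in \sum_(X <= _ < _) pois lam (_ - _)](@subnK (k - i) k.+1); last by lia.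
by rewrite big_addn; apply: eq_bigr => l _; rewrite addnK.
Qed.

(* Solution of the Poisson Stein equation for the singleton [{i}], scaled by [lam]. *)
Definition stein_sol {R : realType} (lam : R) (i k : nat) : R :=
  pois lam i / pois lam k *
  ((i <= k)%:R - \sum_(0 <= l < k.+1) pois lam l).

Lemma stein_sol_le1 (R : realType) (lam : R) (i k : nat) : 0 < lam ->
  `|stein_sol lam i k| <= 1.
Proof.
move=> l0; rewrite /stein_sol.
have qi0 := poisson_gt0 R lam i l0; have qk0 := poisson_gt0 R lam k l0.
have F1 := poisson_sum_le1 R lam k.+1 l0.
have F0 : 0 <= \sum_(0 <= l < k.+1) pois lam l.
  by rewrite sumr_ge0 // => l _; rewrite ltW // poisson_gt0.
rewrite mulrAC normrM normfV (gtr0_norm qk0) ler_pdivrMr // mul1r normrM (gtr0_norm qi0).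
have [ik|ki] := leqP i k.
  by rewrite ger0_norm; [exact: poisson_tail_ratio | rewrite subr_ge0].
by rewrite sub0r normrN ger0_norm // poisson_cdf_ratio // ltnW.
Qed.

(** The Poisson recursion turns (k + 1) / (lam q(k)) into 1 / q(k + 1), so the two partial sums
    differ by one term. The equation is stated at positive indices only, which is where the cutoff
    of [stein_comparison] uses it. *)
Lemma stein_solS (R : realType) (lam : R) (i k : nat) : 0 < lam ->
  stein_sol lam i k.+1 - k.+1%:R / lam * stein_sol lam i k = (i == k.+1)%:R - pois lam i.
Proof.
move=> l0; have qk0 := poisson_gt0 R lam k l0; have qk1 := poisson_gt0 R lam k.+1 l0.
rewrite /stein_sol big_nat_recr //=; set F := \sum_(0 <= l < k.+1) _.
have E : k.+1%:R / lam / pois lam k = (pois lam k.+1)^-1.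
  by rewrite -mulrA -invfM -poisson_recS invfM mulrCA mulfV ?mulr1 // pnatr_eq0.
have -> : k.+1%:R / lam * (pois lam i / pois lam k * ((i <= k)%:R - F)) =
   k.+1%:R / lam / pois lam k * pois lam i * ((i <= k)%:R - F) by ring.
rewrite E leq_eqVlt ltnS; case: eqP => [->|_] /=; last by field; rewrite gt_eqF.
by rewrite ltnn /=; field; rewrite gt_eqF.
Qed.

(** * Comparison of the ratios of consecutive weights *)

(** For d <= 1/2, e^d <= 1 / (1 - d) leaves a remainder of at most 2 d^2; for d > 1/2, 4 d^2 >= 1
    and e^d <= e^D suffice. *)
Lemma expR_quadratic_bound (R : realType) (d D : R) : 0 <= D -> d <= D ->
  `|expR d - 1 - d| <= 4 * expR D * d ^+ 2.
Proof.
move=> D0 dD; have E1 := expR_ge1Dx d.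
have eD : 1 <= expR D by rewrite -expR0 ler_expR.
rewrite ger0_norm; last by lra.
have d2 := sqr_ge0 d.
have [d12|d12] := leP d (1 / 2); last first.
  have : expR d <= expR D by rewrite ler_expR.
  have d4 : 1 <= 4 * d ^+ 2 by nra.
  have : expR D * 1 <= expR D * (4 * d ^+ 2) by rewrite ler_wpM2l ?expR_ge0.
  by lra.
have := expR_ge1Dx (- d); rewrite expRN => H.
have ed := expR_gt0 d.
have {}H : (1 - d) * expR d <= 1 by rewrite -ler_pdivlMr // div1r.
have H2 : expR d * (1 - d) ^+ 2 <= 1 - d.
  by have := ler_wpM2l (_ : 0 <= 1 - d) H; lra.
have : d ^+ 2 * 1 <= d ^+ 2 * expR D by rewrite ler_wpM2l.
by nra.
Qed.

(* Everything is divided by [n]: [x] is the deviation of [K], [v = 1/n], [s + t] the Poisson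
   parameter. The equation satisfied by [s] cancels the term linear in [x]. *)
Lemma ratio_expansion (R : realType) (a b beta s x v t c r : R) :
  0 < a -> 0 < b -> a + b = 1 -> 0 < beta < 1 -> 0 < s ->
  s * (1 - 4 * beta * a * b) = a * b ->
  `|x| <= 1 -> 0 < v <= 1 -> 0 <= t <= v -> 1 <= c <= 3 / 2 ->
  `|(a - x) * b * (1 + 2 * beta * (2 * x + v)) * (s + t + x + c * v)
    - (b + x + v) * a * (s + t)| <= (42 + 5 * s) * (x ^+ 2 + v).
Proof.
move=> a0 b0 ab be s0 sE x1 v01 tv c1.
pose w := t + c * v.
have w0 : 0 <= w by rewrite /w; nra.
have w1 : w <= 5 / 2 * v by rewrite /w; nra.
(* The last two summands are the terms linear in [x]; they vanish by the equation for [s] and by a +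
   b = 1. Each other summand carries x^2, or one of [v], [t], [w], which are all at most 5/2 [v]. *)
have -> : (a - x) * b * (1 + 2 * beta * (2 * x + v)) * (s + t + x + c * v)
    - (b + x + v) * a * (s + t) =
   x ^+ 2 * (b * (4 * beta * (a - s) - 1 - 4 * beta * x)) +
   b * (a - x) * (1 + 4 * beta * x) * w + b * (a - x) * (2 * beta * v) * (s + x + w)
   - v * (a * (s + t)) - (b + x) * a * t + x * (a * b - s * (1 - 4 * beta * a * b))
   + x * s * (1 - a - b).
  by rewrite /w; ring.
rewrite -sE subrr mulr0 -addrA -(addrA 1) -opprD ab subrr mulr0 !addr0.
have x2 := sqr_ge0 x.
move: x1; rewrite ler_norml => /andP[xl xr].
have T1 : `|b * (4 * beta * (a - s) - 1 - 4 * beta * x)| <= 9 + 4 * s.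
  rewrite normrM (gtr0_norm b0).
  have : `|4 * beta * (a - s) - 1 - 4 * beta * x| <= 9 + 4 * s by rewrite ler_norml; nra.
  by nra.
have U : `|b * (a - x)| <= 2 by rewrite ler_norml; nra.
have T2 : `|b * (a - x) * (1 + 4 * beta * x)| <= 10.
  have A1 : `|1 + 4 * beta * x| <= 5 by rewrite ler_norml; nra.
  by rewrite normrM; have := ler_pM (normr_ge0 _) (normr_ge0 _) U A1; lra.
have T3 : `|b * (a - x) * (2 * beta * v) * (s + x + w)| <= 4 * v * (s + 7 / 2).
  have B1 : `|s + x + w| <= s + 7 / 2 by rewrite ler_norml; lra.
  have B2 : `|2 * beta * v| <= 2 * v by rewrite ler_norml; nra.
  have B3 : `|b * (a - x)| * `|2 * beta * v| <= 2 * (2 * v) by rewrite ler_pM.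
  rewrite normrM; apply: (@le_trans _ _ (2 * (2 * v) * (s + 7 / 2))); last by lra.
  by rewrite ler_pM // normrM.
have T4 : `|v * (a * (s + t))| <= v * (s + 1).
  have A1 : `|a * (s + t)| <= s + 1 by rewrite ler_norml; nra.
  have v0 : 0 < v by lra.
  by rewrite normrM (gtr0_norm v0) ler_pM2l.
have T5 : `|(b + x) * a * t| <= 2 * v.
  have A1 : `|(b + x) * a| <= 2 by rewrite ler_norml; nra.
  have t0 : 0 <= t by lra.
  by rewrite normrM (ger0_norm t0) ler_pM //; lra.
have T1' : `|x ^+ 2 * (b * (4 * beta * (a - s) - 1 - 4 * beta * x))| <= x ^+ 2 * (9 + 4 * s).
  by rewrite normrM (ger0_norm x2) ler_wpM2l.
have T2' : `|b * (a - x) * (1 + 4 * beta * x) * w| <= 10 * (5 / 2 * v).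
  by rewrite normrM (ger0_norm w0) ler_pM.
apply: le_trans (ler_normB _ _) _.
apply: le_trans (lerD (ler_normB _ _) T5) _.
apply: le_trans (lerD (lerD (ler_normD _ _) T4) (lexx _)) _.
apply: le_trans (lerD (lerD (lerD (ler_normD _ _) T3) (lexx _)) (lexx _)) _.
by nra.
Qed.

(** The quantity compared with 1 is (P(K+1)/P(K)) (k+1)/lam, where [x] is the centred K and
    e^(2(beta m0 + h)) has become (1 + m0) / (1 - m0). The bound on [x] keeps the density of plus
    spins away from zero. *)
Lemma cw_poisson_ratio (R : realType) (beta m0 s : R) :
  0 < beta < 1 -> -1 < m0 < 1 ->
  s = (1 - m0 ^+ 2) / (4 * (1 - beta + beta * m0 ^+ 2)) ->
  exists2 C : R, 0 <= C & forall n x lam c : R, 1 <= n ->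
    `|x| <= n * ((1 + m0) / 4) -> n * s <= lam <= n * s + 1 -> 1 <= c <= 3 / 2 ->
    `|1 - (n * (1 - m0) / 2 - x) / (n * (1 + m0) / 2 + x + 1) * ((1 + m0) / (1 - m0))
          * expR (2 * (beta * (2 * x + 1) / n)) * ((lam + x + c) / lam)|
    <= C * ((x ^+ 2 + n) / n ^+ 2).
Proof.
move=> be m01 sE.
have [a aE] : exists a : R, a = (1 - m0) / 2 by exists ((1 - m0) / 2).
have [b bE] : exists b : R, b = (1 + m0) / 2 by exists ((1 + m0) / 2).
have a0 : 0 < a by rewrite aE; lra.
have b0 : 0 < b by rewrite bE; lra.
have ab : a + b = 1 by rewrite aE bE; lra.
have m2 : 0 <= m0 ^+ 2 by exact: sqr_ge0.
have den : 0 < 4 * (1 - beta + beta * m0 ^+ 2) by nra.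
have s0 : 0 < s by rewrite sE divr_gt0 //; nra.
have sE' : s * (1 - 4 * beta * a * b) = a * b.
  by rewrite sE aE bE; field; rewrite gt_eqF //; lra.
(* The first part comes from [ratio_expansion], with the exponential replaced by 1 + d. The rest
   bounds the remainder [r]: |d| <= 6, and 128 = 4 * 32 combines [expR_quadratic_bound] with d^2 <=
   32 (xi^2 + v). *)
pose C0 := 42 + 5 * s + 2 * (128 * expR 6) * (s + 4).
have C00 : 0 <= C0.
  have e6 : 0 <= expR 6 :> R by exact: expR_ge0.
  by have := mulr_ge0 e6 (ltW s0); rewrite /C0; lra.
(* The numerator is at most C0 (xi^2 + v), and the common denominator at least a s b / 2. *)
exists (C0 * (2 / (a * s * b))).
  by rewrite mulr_ge0 // divr_ge0 //; apply/ltW; rewrite !mulr_gt0.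
move=> n x lam c n1 xb lamb c1.
have n0 : 0 < n by lra.
have [xi xiE] : exists xi, xi = x / n by exists (x / n).
have [v vE] : exists v, v = n^-1 by exists n^-1.
have [t tE] : exists t, t = lam / n - s by exists (lam / n - s).
have xE : x = n * xi by rewrite xiE mulrC divfK // gt_eqF.
have lE : lam = n * (s + t) by rewrite tE addrC subrK mulrC divfK // gt_eqF.
have nv : n * v = 1 by rewrite vE divff // gt_eqF.
have v0 : 0 < v by rewrite vE invr_gt0.
have v1 : v <= 1 by rewrite vE invf_le1.
have tv : 0 <= t <= v.
  rewrite tE subr_ge0 ler_pdivlMr // mulrC lerBlDr ler_pdivrMr //.
  rewrite mulrDl [v * n]mulrC nv [s * n]mulrC; lra.
have xib : `|xi| <= b / 2.
  rewrite xiE normrM normfV (gtr0_norm n0) ler_pdivrMr // bE; lra.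
have xi1 : `|xi| <= 1 by apply: le_trans xib _; lra.
move: (xib); rewrite ler_norml => /andP[xil xir].
have l0 : 0 < s + t by lra.
have dd : 0 < b + xi + v by lra.
pose d := 2 * beta * (2 * xi + v).
have dE : 2 * (beta * (2 * x + 1) / n) = d.
  by rewrite /d xE vE; field; rewrite gt_eqF.
pose r := expR d - 1 - d.
pose N := (a - xi) * b * (1 + d + r) * (s + t + xi + c * v) - (b + xi + v) * a * (s + t).
have -> : 1 - (n * (1 - m0) / 2 - x) / (n * (1 + m0) / 2 + x + 1) * ((1 + m0) / (1 - m0))
     * expR (2 * (beta * (2 * x + 1) / n)) * ((lam + x + c) / lam)
   = - (N / (a * (s + t) * (b + xi + v))).
  rewrite dE (_ : expR d = 1 + d + r); last by rewrite /r; ring.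
  have e1 : n * (1 - m0) / 2 - x = n * (a - xi) by rewrite xE aE; ring.
  have e2 : n * (1 + m0) / 2 + x + 1 = n * (b + xi + v).
    by rewrite xE bE !mulrDr nv; field.
  have e3 : (1 + m0) / (1 - m0) = b / a by rewrite aE bE; field; lra.
  have e4 : lam + x + c = n * (s + t + xi + c * v).
    by rewrite lE xE !mulrDr mulrCA nv mulr1.
  rewrite e1 e2 e3 e4 lE /N; field.
  by rewrite !gt_eqF.
have -> : (x ^+ 2 + n) / n ^+ 2 = xi ^+ 2 + v.
  by rewrite xiE vE; field; rewrite gt_eqF.
clear xiE vE tE xE lE nv lamb xb sE m01 m2 den aE bE n1 dE.
have c2 : `|s + t + xi + c * v| <= s + 4.
  have cv : c * v <= 3 / 2 * v by rewrite ler_wpM2r //; lra.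
  have cv0 : 0 <= c * v by rewrite mulr_ge0 //; lra.
  by rewrite ler_norml; lra.
have c3 : `|(a - xi) * b| <= 2.
  rewrite normrM (gtr0_norm b0) -[leRHS]mulr1; apply: ler_pM => //; [exact: ltW | | lra].
  by rewrite ler_norml; lra.
have dl : `|2 * xi + v| <= 3.
  by rewrite ler_norml; lra.
have d6 : `|d| <= 6.
  rewrite /d normrM ger0_norm; last by lra.
  by have := normr_ge0 (2 * xi + v); nra.
have v2 : v ^+ 2 <= v by nra.
have xi2 := sqr_ge0 xi.
have dsq : d ^+ 2 <= 32 * (xi ^+ 2 + v).
  have : d ^+ 2 <= 4 * (2 * xi + v) ^+ 2.
    rewrite /d exprMn ler_wpM2r ?sqr_ge0 //; nra.
  have : (2 * xi + v) ^+ 2 <= 2 * (4 * xi ^+ 2 + v ^+ 2).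
    by rewrite -subr_ge0; apply: le_trans (sqr_ge0 (2 * xi - v)) _; lra.
  by lra.
have rb : `|r| <= 128 * expR 6 * (xi ^+ 2 + v).
  apply: le_trans (@expR_quadratic_bound R d 6 _ _) _ => //.
    by apply: le_trans d6; exact: ler_norm.
  have := expR_gt0 (6 : R); nra.
have NE : N = ((a - xi) * b * (1 + d) * (s + t + xi + c * v) - (b + xi + v) * a * (s + t))
   + (a - xi) * b * r * (s + t + xi + c * v) by rewrite /N; ring.
have Nb : `|N| <= C0 * (xi ^+ 2 + v).
  rewrite NE; apply: le_trans (ler_normD _ _) _.
  have -> : C0 * (xi ^+ 2 + v) = (42 + 5 * s) * (xi ^+ 2 + v) +
            2 * (128 * expR 6 * (xi ^+ 2 + v)) * (s + 4) by rewrite /C0; ring.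
  apply: lerD.
    by apply: ratio_expansion => //; apply/andP.
  rewrite normrM [`|_ * r|]normrM.
  by rewrite ler_pM ?mulr_ge0 // ler_pM.
have D0 : 0 < a * s * b / 2 by rewrite divr_gt0 // !mulr_gt0.
have D1 : a * s * b / 2 <= a * (s + t) * (b + xi + v).
  rewrite -mulrA; apply: ler_pM; last by lra.
  - by rewrite ltW // mulr_gt0.
  - by rewrite ltW // divr_gt0.
  - by rewrite ler_pM2l //; lra.
rewrite normrN (normrM N) normfV; rewrite [leRHS]mulrAC; have D2 := lt_le_trans D0 D1.
rewrite (gtr0_norm D2); apply: ler_pM => //; first by rewrite invr_ge0 ltW.
rewrite -[leRHS]invrK invf_div lef_pV2 // posrE.
Qed.

(** * Local distance *)

(* The cutoff [chi] keeps the Poisson index [K + s] positive, so that the summation by parts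
   has no boundary term. *)
Lemma stein_comparison (R : realType) (n : nat) (P : nat -> R) (chi : pred nat)
    (lam : R) (s : int) (i : nat) :
  0 < lam -> (forall K, 0 <= P K) -> P n.+1 = 0 -> \sum_(K < n.+1) P K = 1 ->
  ~~ chi 0 -> (forall K, chi K -> 0 < K%:Z + s) ->
  `|\sum_(K < n.+1) P K * (K%:Z + s == i%:Z)%:R - pois lam i| <=
  \sum_(K < n.+1) P K * (~~ chi K)%:R +
  \sum_(K < n.+1) `|P K * (chi K)%:R - P K.+1 * (chi K.+1)%:R * ((K.+1%:Z + s)%:~R / lam)|.
Proof.
move=> l0 P0 Pn sumP chi0 chis.
pose d (K : nat) : R := (K%:Z + s == i%:Z)%:R - pois lam i.
have qi1 : pois lam i <= 1.
  have := poisson_sum_range_le1 R lam i i.+1 l0; by rewrite big_nat1.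
have qi0 := poisson_gt0 R lam i l0.
have d1 K : `|d K| <= 1 by rewrite /d; case: eqP => _ /=; rewrite ler_norml; lra.
pose g (K : nat) := stein_sol lam i `|(K%:Z + s)%R|%N.
have g1 K : `|g K| <= 1 by exact: stein_sol_le1.
have dS K : chi K.+1 -> d K.+1 = g K.+1 - (K.+1%:Z + s)%:~R / lam * g K.
  move=> /chis cK; pose k := `|(K%:Z + s)%R|%N.
  have ks : K%:Z + s = k%:Z by rewrite /k gez0_abs //; lia.
  have kS : K.+1%:Z + s = k.+1%:Z by lia.
  rewrite /g /d kS ks !absz_nat -pmulrn stein_solS //.
  by rewrite eqz_nat eq_sym.
(* As [P] has mass one, the difference is the mean of [d] under [P]; it is split according to the
   cutoff. *)
have -> : \sum_(K < n.+1) P K * (K%:Z + s == i%:Z)%:R - pois lam i =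
   \sum_(K < n.+1) P K * (~~ chi K)%:R * d K + \sum_(K < n.+1) P K * (chi K)%:R * d K.
  have qE : pois lam i = \sum_(K < n.+1) P K * pois lam i by rewrite -mulr_suml sumP mul1r.
  rewrite -big_split [in LHS]qE -sumrB /=.
  apply: eq_bigr => K _; rewrite -mulrDl -mulrDr -mulrBr.
  by case: (chi K); rewrite ?addr0 ?add0r mulr1.
apply: le_trans (ler_normD _ _) _; apply: lerD.
  apply: le_trans (ler_norm_sum _ _ _) _; apply: ler_sum => K _.
  rewrite normrM ger0_norm ?mulr_ge0 // -[leRHS]mulr1.
  by rewrite ler_wpM2l ?mulr_ge0.
(* Summation by parts: [d] is replaced by the Stein equation and the first half is shifted back by
   one. No boundary term appears, since [chi 0] fails and [P n.+1] is zero. *)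
have -> : \sum_(K < n.+1) P K * (chi K)%:R * d K =
  \sum_(K < n.+1) (P K * (chi K)%:R - P K.+1 * (chi K.+1)%:R * ((K.+1%:Z + s)%:~R / lam)) * g K.
  transitivity (\sum_(K < n.+1) P K * (chi K)%:R * g K -
     \sum_(K < n.+1) P K.+1 * (chi K.+1)%:R * ((K.+1%:Z + s)%:~R / lam) * g K); last first.
    by rewrite -sumrB; apply: eq_bigr => K _; rewrite mulrBl.
  rewrite big_ord_recl [X in X - _]big_ord_recl [X in _ - X]big_ord_recr /=.
  rewrite (negbTE chi0) Pn !(mulr0, mul0r) !add0r addr0 -sumrB.
  apply: eq_bigr => K _; rewrite /bump /= add1n.
  have [/dS ->|_] := boolP (chi K.+1) => /=; ring.
apply: le_trans (ler_norm_sum _ _ _) _; apply: ler_sum => K _.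
by rewrite normrM -[leRHS]mulr1 ler_wpM2l.
Qed.

Lemma cw_ratio_coef_gt0 (R : realType) (beta m0 : R) : 0 < beta < 1 -> -1 < m0 < 1 ->
  0 < (1 - m0 ^+ 2) / (4 * (1 - beta + beta * m0 ^+ 2)).
Proof.
move=> be m01; have m2 := sqr_ge0 m0.
by rewrite divr_gt0 //; nra.
Qed.

(** A point within distance 1 of one outside the cutoff is itself of order [n], so its weight is
    bounded below. This pays for the terms where only one of K, K + 1 is inside. *)
Lemma far_weight (R : realType) (e n x z : R) : 0 < e -> 1 <= n ->
  e * n < `|z| -> `|z - x| <= 1 -> e ^+ 2 / 2 <= (x ^+ 2 + n) / n ^+ 2.
Proof.
move=> e0 n1 ez zx.
rewrite ler_pdivlMr ?exprn_gt0 //; last by lra.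
have h1 : `|z| <= `|x| + 1.
  by rewrite -(subrK x z) addrC; apply: le_trans (ler_normD _ _) _; rewrite lerD2l.
have h2 : (e * n) ^+ 2 <= (`|x| + 1) ^+ 2.
  have h0 : 0 <= e * n by rewrite mulr_ge0 // ltW //; lra.
  by rewrite !expr2; apply: ler_pM => //; lra.
have h3 : (`|x| + 1) ^+ 2 <= 2 * x ^+ 2 + 2.
  rewrite -[x ^+ 2]real_normK ?num_real // -subr_ge0.
  by apply: le_trans (sqr_ge0 (`|x| - 1)) _; lra.
by move: h2; rewrite exprMn; lra.
Qed.

(** The ratio estimate enters [stein_comparison] and is summed by the second moment. The second
    conclusion concerns atoms below the support of the Poisson law: they lie outside the cutoff,
    whose mass is already O(1/n). *)
Lemma cw_poisson_loc (R : realType) (beta h m0 : R)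
    (sg : R := (1 - m0 ^+ 2) / (4 * (1 - beta + beta * m0 ^+ 2))) :
  0 < beta < 1 -> m0 = tanh (beta * m0 + h) ->
  exists2 C : R, 0 <= C & forall (n : nat) (s : int) (lam : R), (0 < n)%N ->
    n%:R * sg <= lam <= n%:R * sg + 1 ->
    s%:~R = lam - n%:R * (1 + m0) / 2 + delta n / 2 ->
    (forall i : nat, `|\sum_(K < n.+1) cw_plus n beta h K * (K%:Z + s == i%:Z)%:R
        - pois lam i| <= C / n%:R) /\
    (forall K : nat, K%:Z + s < 0 -> cw_plus n beta h K <= C / n%:R).
Proof.
move=> be m0E.
have m01 : -1 < m0 < 1 by rewrite m0E tanh_gtrN1 tanh_ltr1.
have sg0 : 0 < sg := cw_ratio_coef_gt0 R beta m0 be m01.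
have [C1 C10 ratio] := cw_poisson_ratio R beta m0 sg be m01 erefl.
move: sg0 ratio; move: sg => sg sg0 ratio.
have b1 : 0 < 1 - beta by lra.
(* Bounds [n] times the sum of [Psi]: the 1/4 arises because 2 K - n - n m0 is 2 x, and the final 1
   from the summand [n] in x^2 + n. *)
have [Cv [Cv0 CvE]] : exists Cv : R, 0 <= Cv /\ Cv = (4 + 9 / (1 - beta)) / (1 - beta) / 4 + 1.
  eexists; split; last by [].
  have : 0 <= 9 / (1 - beta) by rewrite divr_ge0 // ltW.
  by move=> ?; rewrite addr_ge0 // !divr_ge0 // ?ltW //; lra.
(* The cutoff |x| <= e n must be within the range of [cw_poisson_ratio], hence (1 + m0) / 4, and
   must keep the Poisson index lam + x + delta / 2 positive, hence sg / 2. *)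
have [e [e0 eb es]] : exists e : R, [/\ 0 < e, e <= (1 + m0) / 4 & e <= sg / 2].
  exists (Num.min ((1 + m0) / 4) (sg / 2)); split.
  - by rewrite lt_min; apply/andP; split; lra.
  - by rewrite ge_min lexx.
  - by rewrite ge_min lexx orbT.
have e1 : e <= 1 / 2 by lra.
have [C2 [C20 C2E]] : exists C2 : R, 0 <= C2 /\ C2 = 2 / e ^+ 2.
  by eexists; split; last by []; rewrite divr_ge0 // ltW // exprn_gt0.
(* Bounds the factor (k + 1) / lam when K + 1 is inside the cutoff; lam >= n sg turns a multiple of
   n / lam into one of 1 / sg. *)
have [C3 [C30 C3E]] : exists C3 : R, 0 <= C3 /\ C3 = 1 + 5 / 2 / sg.
  by eexists; split; last by []; rewrite addr_ge0 // divr_ge0 // ltW.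
have [C4 [C40 C14 C24 C34]] : exists C4 : R,
    [/\ 0 <= C4, C1 <= C4, C2 <= C4 & C2 * C3 <= C4].
  by have C230 := mulr_ge0 C20 C30; exists (C1 + C2 + C2 * C3); split; lra.
have m0n : 1 - m0 != 0 by rewrite gt_eqF //; lra.
(* One share for the mass outside the cutoff, one each for the sums of [Psi K] and [Psi K.+1]. *)
exists (3 * C4 * Cv) => [|n s lam n0 lamb sE]; first by rewrite !mulr_ge0.
have nR : 0 < n%:R :> R by rewrite ltr0n.
have n1 : 1 <= n%:R :> R by rewrite ler1n.
have sn0 := mulr_gt0 sg0 nR.
have lam0 : 0 < lam by lra.
have lamC3 : lam + 5 / 2 * n%:R <= lam * C3.
  have -> : lam * C3 = lam + 5 / 2 * (lam / sg) by rewrite C3E; field; rewrite gt_eqF.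
  by rewrite lerD2l ler_pM2l // ler_pdivlMr //; lra.
have dl : 0 <= delta (R:=R) n <= 1.
  by rewrite /delta -signr_odd; case: (odd n); rewrite ?expr1 ?expr0 /=; lra.
have c1 : 1 <= 1 + delta (R:=R) n / 2 <= 3 / 2 by lra.
pose P := cw_plus n beta h.
have P0 K : 0 <= P K by exact: cw_plus_ge0.
pose x (K : nat) : R := K%:R - n%:R * (1 + m0) / 2.
have xS K : x K.+1 = x K + 1 by rewrite /x -natr1; ring.
pose chi (K : nat) := `|x K| <= e * n%:R.
pose Psi K := P K * ((x K ^+ 2 + n%:R) / n%:R ^+ 2).
have w0 K : 0 <= (x K ^+ 2 + n%:R) / n%:R ^+ 2.
  by rewrite divr_ge0 ?exprn_ge0 // addr_ge0 ?sqr_ge0.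
have Psi0 K : 0 <= Psi K by rewrite mulr_ge0.
have sumPsi : \sum_(K < n.+1) Psi K <= Cv / n%:R.
  have -> : \sum_(K < n.+1) Psi K = (4^-1 * \sum_(K < n.+1) P K * (2 * K%:R - n%:R - n%:R * m0) ^+ 2
     + n%:R) / n%:R ^+ 2.
    have nE : n%:R = \sum_(K < n.+1) P K * n%:R by rewrite -mulr_suml sum_cw_plus mul1r.
    rewrite [X in _ + X]nE mulr_sumr -big_split /= mulr_suml.
    by apply: eq_bigr => K _; rewrite /Psi /x /P; field; rewrite gt_eqF.
  have := cw_second_moment R beta h m0 n be m0E n0.
  set V := \sum_(K < _) _ => HV.
  rewrite ler_pdivrMr ?exprn_gt0 // expr2 mulrA divfK ?gt_eqF //.
  by rewrite CvE; lra.
clear CvE C3E.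
have sumPsiS : \sum_(K < n.+1) Psi K.+1 <= Cv / n%:R.
  apply: le_trans sumPsi.
  rewrite big_ord_recr [leRHS]big_ord_recl /= {2}/Psi /P cw_plus_gtn // mul0r addr0.
  by rewrite lerDr.
have far K L : `|x K - x L| <= 1 -> ~~ chi L -> 1 <= C2 * ((x K ^+ 2 + n%:R) / n%:R ^+ 2).
  rewrite /chi -ltNge distrC => xy cL.
  have := far_weight R e n%:R (x K) (x L) e0 n1 cL xy.
  have e2 : 0 < e ^+ 2 by rewrite exprn_gt0.
  move=> /(ler_wpM2l C20); apply: le_trans.
  by rewrite C2E le_eqVlt; apply/orP; left; apply/eqP; field; rewrite gt_eqF.
have out K : P K * (~~ chi K)%:R <= C2 * Psi K.
  have [_|cK] := boolP (chi K); first by rewrite mulr0 mulr_ge0.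
  rewrite mulrCA ler_wpM2l //; apply: far cK.
  by rewrite subrr normr0.
have chi0 : ~~ chi 0.
  rewrite /chi -ltNge /x sub0r normrN ger0_norm; last by rewrite divr_ge0 ?mulr_ge0 //; lra.
  by rewrite mulrC -mulrA ltr_pM2l //; lra.
have kE K : (K%:Z + s)%:~R = lam + x K + delta n / 2.
  by rewrite rmorphD /= sE -pmulrn /x; ring.
have chis K : chi K -> 0 < K%:Z + s.
  rewrite /chi ler_norml => /andP[xl _].
  rewrite -(ltr_int R) kE.
  have : e * n%:R <= sg / 2 * n%:R by rewrite ler_pM2r.
  by lra.
have sumout : \sum_(K < n.+1) P K * (~~ chi K)%:R <= C4 * Cv / n%:R.
  apply: (@le_trans _ _ (\sum_(K < n.+1) C2 * Psi K)); first by apply: ler_sum.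
  rewrite -mulr_sumr -mulrA; apply: ler_pM => //.
  by apply: sumr_ge0.
have CC : C4 * Cv / n%:R <= 3 * C4 * Cv / n%:R.
  by rewrite ler_pM2r ?invr_gt0 // ler_wpM2r //; lra.
split=> [i|K Ks]; last first.
  apply: le_trans CC; apply: le_trans sumout.
  have cK : ~~ chi K by apply/negP => /chis /(lt_trans Ks); rewrite ltxx.
  have [Kn|nK] := ltnP K n.+1; last first.
    by rewrite cw_plus_gtn // sumr_ge0 // => L _; rewrite mulr_ge0.
  rewrite (bigD1 (Ordinal Kn)) //= cK mulr1 lerDl sumr_ge0 // => L _.
  by rewrite mulr_ge0.
apply: le_trans (stein_comparison R n P chi lam s i lam0 P0 _ (sum_cw_plus R n beta h) chi0 chis) _.
  by rewrite /P cw_plus_gtn.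
suff step K : (K < n.+1)%N ->
    `|P K * (chi K)%:R - P K.+1 * (chi K.+1)%:R * ((K.+1%:Z + s)%:~R / lam)|
    <= C4 * Psi K + C4 * Psi K.+1.
  have : \sum_(K < n.+1) `|P K * (chi K)%:R - P K.+1 * (chi K.+1)%:R * ((K.+1%:Z + s)%:~R / lam)|
     <= C4 * Cv / n%:R + C4 * Cv / n%:R.
    apply: (@le_trans _ _ (\sum_(K < n.+1) (C4 * Psi K + C4 * Psi K.+1))).
      by apply: ler_sum => K _; exact: step.
    rewrite big_split /= -!mulr_sumr -!mulrA; apply: lerD; exact: ler_wpM2l.
  by lra.
move=> Kn; clear C2E es e0 b1 sumPsi sumPsiS sumout CC chi0 Kn.
have x1 L : `|x L.+1 - x L| <= 1 by rewrite xS addrC addKr normr1.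
have x1' L : `|x L - x L.+1| <= 1 by rewrite distrC.
have le4 c a b : 0 <= c -> 0 <= a -> 0 <= b -> c <= C4 -> c * a <= C4 * a + C4 * b.
  by move=> ? ? ? ?; rewrite -[leLHS]addr0 lerD ?ler_wpM2r ?mulr_ge0.
(* Both indices inside: the ratio estimate. Exactly one inside: its whole term is an error paid by
   [far]. Neither: the term is zero. *)
have [cK|cK] := boolP (chi K); have [cS|cS] := boolP (chi K.+1); rewrite ?mulr1 ?mulr0 ?mul0r.
- have K1 : K.+1%:R = n%:R * (1 + m0) / 2 + x K + 1 :> R by rewrite /x -natr1; ring.
  have cb : `|x K| <= n%:R * ((1 + m0) / 4).
    by apply: le_trans cK _; rewrite mulrC ler_pM2l.
  have H := ratio n%:R (x K) lam (1 + delta n / 2) n1 cb lamb c1.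
  have -> : P K - P K.+1 * ((K.+1%:Z + s)%:~R / lam) = P K *
    (1 - (n%:R * (1 - m0) / 2 - x K) / (n%:R * (1 + m0) / 2 + x K + 1) * ((1 + m0) / (1 - m0))
          * expR (2 * (beta * (2 * x K + 1) / n%:R)) * ((lam + x K + (1 + delta n / 2)) / lam)).
    have -> : P K.+1 = P K * (n%:R - K%:R) *
        expR (2 * (beta * (2 * K%:R - n%:R + 1) / n%:R + h)) / K.+1%:R.
      by rewrite -cw_plusS // mulfK // pnatr_eq0.
    have -> : 2 * (beta * (2 * K%:R - n%:R + 1) / n%:R + h) =
       2 * (beta * m0 + h) + 2 * (beta * (2 * x K + 1) / n%:R).
      by rewrite /x; field; rewrite gt_eqF.
    have -> : n%:R - K%:R = n%:R * (1 - m0) / 2 - x K by rewrite /x; field.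
    rewrite expRD kE xS -K1.
    have -> : expR (2 * (beta * m0 + h)) = (1 + m0) / (1 - m0).
      rewrite [in X in _ / X]m0E [in X in X / _]m0E -expR_tanh mulfK //.
      by rewrite -m0E.
    have -> : lam + (x K + 1) + delta n / 2 = lam + x K + (1 + delta n / 2) by ring.
    by ring.
  rewrite normrM (ger0_norm (P0 K)).
  apply: (@le_trans _ _ (C1 * Psi K)).
    by rewrite [leRHS]mulrCA ler_wpM2l.
  exact: le4.
- rewrite subr0 ger0_norm //; apply: (@le_trans _ _ (C2 * Psi K)).
    by rewrite [leRHS]mulrCA -[leLHS]mulr1 ler_wpM2l //; apply: far cS.
  exact: le4.
- rewrite sub0r normrN normrM (ger0_norm (P0 _)).
  apply: (@le_trans _ _ (C2 * C3 * Psi K.+1)); last first.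
    by rewrite addrC; apply: le4 => //; rewrite mulr_ge0.
  rewrite [leRHS]mulrCA ler_wpM2l // mulrAC -[leLHS]mul1r.
  apply: ler_pM => //; first by apply: far cK.
  rewrite normrM normfV (gtr0_norm lam0) ler_pdivrMr // kE.
  move: cS; rewrite /chi mulrC => cS.
  have : `|lam + x K.+1 + delta n / 2| <= lam + `|x K.+1| + delta n / 2.
    apply: le_trans (ler_normD _ _) _; apply: lerD; last by rewrite ger0_norm //; lra.
    by apply: le_trans (ler_normD _ _) _; rewrite (gtr0_norm lam0).
  have : n%:R * e <= n%:R * (1 / 2) by rewrite ler_pM2l.
  by lra.
- by rewrite subrr normr0 addr_ge0 // mulr_ge0.
Qed.

(** * Total variation distance *)

Lemma law_shifted_sum (R : realType) (n : nat) (beta h : R) (j : int) :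
  law_shifted n beta h j =
  \sum_(K < n.+1) cw_plus n beta h K * (K%:Z - n./2%:Z == j)%:R.
Proof.
have [j0|j0] := ltP (j + n./2%:Z) 0.
  rewrite law_shifted_lt // big1 // => K _.
  by rewrite (_ : (_ == j) = false) ?mulr0 //; apply/eqP => E; lia.
have [L ->] : exists L : nat, j = L%:Z - n./2%:Z.
  by exists `|(j + n./2%:Z)%R|%N; rewrite gez0_abs // addrK.
rewrite law_shifted_natB; have [Ln|nL] := ltnP L n.+1.
  rewrite (bigD1 (Ordinal Ln)) //= eqxx mulr1 big1 ?addr0 // => K KL.
  rewrite (_ : (_ == _) = false) ?mulr0 //; apply/eqP => E.
  by move/eqP: KL; apply; apply: val_inj => /=; lia.
rewrite cw_plus_gtn // big1 // => K _.
by rewrite (_ : (_ == _) = false) ?mulr0 //; apply/eqP => E; have := ltn_ord K; lia.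
Qed.

Lemma law_shifted_ge0 (R : realType) (n : nat) (beta h : R) (j : int) :
  0 <= law_shifted n beta h j.
Proof. by rewrite law_shifted_sum sumr_ge0 // => K _; rewrite mulr_ge0 // cw_plus_ge0. Qed.

Lemma TP_pmf_ge0 (R : realType) (mu s2 : R) (j : int) : 0 < s2 -> 0 <= TP_pmf mu s2 j.
Proof.
move=> s0; rewrite /TP_pmf; case: ifP => // _; apply/ltW/poisson_gt0.
by have := floor_le (mu - s2); lra.
Qed.

(** Enumerating a set that carries [g] reduces the unordered sum over the integers to an ordinary
    series. *)
Lemma esum_range (R : realType) (e : nat -> int) (g : int -> R) (l : R) :
  injective e -> (forall j, 0 <= g j) -> (forall j, (forall k, j <> e k) -> g j = 0) ->
  (series (g \o e) @ \oo --> l)%classic ->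
  (\esum_(j in [set: int]) (g j)%:E = l%:E)%E.
Proof.
move=> einj g0 gout cl.
transitivity (\esum_(j in range e) (g j)%:E)%E.
  rewrite [RHS]esum_mkcond; apply: eq_esum => j _.
  case: ifPn => // /negP ej; rewrite gout // => k jk.
  by apply: ej; rewrite inE; exists k.
rewrite (reindex_esum setT (range e) e); last first.
  split; [by move=> k _; exists k | by move=> x y _ _; exact: einj |].
  by move=> j [k _ <-]; exists k.
rewrite -nneseries_esumT => [|k]; last by rewrite lee_fin.
rewrite -(cvg_lim _ cl) // -EFin_lim; last exact: cvgP cl.
congr (limn _); apply/funext => N /=.
by rewrite /series /= sumEFin.
Qed.

Lemma esum_TP_pmf (R : realType) (mu s2 : R) : 0 < s2 ->
  (\esum_(j in [set: int]) (TP_pmf mu s2 j)%:E = 1)%E.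
Proof.
move=> s0; pose a := Num.floor (mu - s2).
apply: (@esum_range R (fun k => k%:Z + a)).
- by move=> k l /addIr [].
- by move=> j; exact: TP_pmf_ge0.
- move=> j jk; rewrite /TP_pmf -/a; case: ifP => // ja.
  by case: (jk `|(j - a)%R|%N); rewrite gez0_abs // subrK.
have -> : TP_pmf mu s2 \o (fun k => k%:Z + a) = pois (s2 + (mu - s2 - a%:~R)).
  by apply/funext => k; rewrite /TP_pmf /= -/a addrK.
exact: poisson_series_cvg.
Qed.

(** Stated for a general [f] to serve twice: the identity for the total mass, and truncation at C /
    n for [esum_dist_le]. *)
Lemma esum_law_shifted (R : realType) (n : nat) (beta h : R) (f : R -> R) :
  f 0 = 0 -> (forall y, 0 <= y -> 0 <= f y) ->
  (\esum_(j in [set: int]) (f (law_shifted n beta h j))%:E =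
   (\sum_(K < n.+1) f (cw_plus n beta h K))%:E)%E.
Proof.
move=> f0 fge; apply: (@esum_range R (fun k => k%:Z - n./2%:Z)).
- by move=> k l /addIr [].
- by move=> j; rewrite fge // law_shifted_ge0.
- move=> j jk; rewrite law_shifted_lt ?f0 //; rewrite ltNge; apply/negP => j0.
  by case: (jk `|(j + n./2%:Z)%R|%N); rewrite gez0_abs // addrK.
apply: cvg_near_cst; exists n.+1 => // N /= nN.
rewrite /series /= (big_cat_nat (leq0n n.+1) nN) /=.
rewrite [X in _ + X]big_nat_cond [X in _ + X]big1 ?addr0.
  by rewrite big_mkord; apply: eq_bigr => K _; rewrite law_shifted_natB.
by move=> K /andP[/andP[nK _] _]; rewrite law_shifted_natB cw_plus_gtn.
Qed.

(* Since p and q have the same mass, summing [|p - q| + p <= q + 2 min(p, D)] suffices. *)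
Lemma esum_dist_le (R : realType) (p q : int -> R) (D : R) :
  (forall j, 0 <= p j) -> (forall j, 0 <= q j) -> (forall j, `|p j - q j| <= D) ->
  (\esum_(j in [set: int]) (p j)%:E = 1)%E -> (\esum_(j in [set: int]) (q j)%:E = 1)%E ->
  (\esum_(j in [set: int]) (`|p j - q j|)%:E <=
   \esum_(j in [set: int]) (Num.min (p j) D)%:E + \esum_(j in [set: int]) (Num.min (p j) D)%:E)%E.
Proof.
move=> p0 q0 pqD sp sq.
have D0 : 0 <= D by apply: le_trans (pqD 0).
have m0 j : 0 <= Num.min (p j) D by rewrite le_min p0.
have H : (\esum_(j in [set: int]) (`|p j - q j|)%:E + 1 <=
   1 + (\esum_(j in [set: int]) (Num.min (p j) D)%:E +
   \esum_(j in [set: int]) (Num.min (p j) D)%:E))%E.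
  rewrite -{1}sp -sq -!esumD; try by (move=> j _; rewrite ?adde_ge0 ?lee_fin).
  apply: le_esum => j _; rewrite -!EFinD lee_fin.
  have := pqD j; case: (leP (q j) (p j)) => [qp|pq].
    rewrite ger0_norm ?subr_ge0 // => H.
    have : p j - q j <= Num.min (p j) D by rewrite le_min H andbT; have := q0 j; lra.
    by lra.
  by rewrite ltr0_norm ?subr_lt0 // => _; have := m0 j; lra.
by move: H; rewrite addeC leeD2lE.
Qed.

Lemma count_interval_le (R : realType) (a b : R) (N : nat) : a <= b ->
  \sum_(K < N) ((a <= K%:R) && (K%:R <= b))%:R <= b - a + 1.
Proof.
move=> ab.
(* Strengthened for induction on [N]: the count is at most any c >= 0 that exceeds N - a or b + 1 -
   a. A counted last index lies in [a, b], so c - 1 works for the others. *)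
suff S c : 0 <= c -> N%:R - a <= c \/ b + 1 - a <= c ->
    \sum_(K < N) ((a <= K%:R) && (K%:R <= b))%:R <= c.
  by apply: S; [lra | right; lra].
elim: N c => [|N IH] c c0 Hc; first by rewrite big_ord0.
rewrite big_ord_recr /= -natr1 in Hc *.
have [/andP[aN Nb]|_] := boolP ((a <= N%:R) && _) => /=.
  by rewrite -lerBrDr; apply: IH; [|left]; lra.
by rewrite addr0; apply: IH => //; case: Hc => ?; [left | right]; lra.
Qed.

(** Within distance [L] of [m] there are at most 2 L + 1 integers, each contributing at most [D];
    beyond, Chebyshev's inequality applies. *)
Lemma sum_min_le (R : realType) (n : nat) (P : nat -> R) (m D V L : R) :
  (forall K, 0 <= P K) -> 0 <= D -> 0 < L ->
  \sum_(K < n.+1) P K * (K%:R - m) ^+ 2 <= V ->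
  \sum_(K < n.+1) Num.min (P K) D <= (2 * L + 1) * D + V / L ^+ 2.
Proof.
move=> P0 D0 L0 HV; have L2 : 0 < L ^+ 2 by rewrite exprn_gt0.
apply: (@le_trans _ _ (\sum_(K < n.+1) (((m - L <= K%:R) && (K%:R <= m + L))%:R * D
   + P K * (K%:R - m) ^+ 2 / L ^+ 2))).
  apply: ler_sum => K _; rewrite ge_min.
  have [_|/nandP out] := boolP ((m - L <= K%:R) && _) => /=.
    by apply/orP; right; rewrite mul1r lerDl divr_ge0 ?(ltW L2) // mulr_ge0 // sqr_ge0.
  apply/orP; left; rewrite mul0r add0r -mulrA -{1}[P K]mulr1 ler_wpM2l // ler_pdivlMr // mul1r.
  by rewrite -ltNge -ltNge in out; case: out => ?; nra.
rewrite big_split /= -!mulr_suml; apply: lerD.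
  apply: ler_wpM2r => //; apply: le_trans (@count_interval_le R _ _ _ _) _; lra.
by rewrite ler_pM2r ?invr_gt0.
Qed.

(** With a = floor(mu - s2), the Poisson index of K is K - floor(n/2) - a, and the parameter exceeds
    s2 by less than 1. For j < a the translated Poisson mass is zero and the second conclusion of
    [cw_poisson_loc] applies. *)
Lemma cw_TP_loc (R : realType) (beta h m0 : R) :
  0 < beta < 1 -> m0 = tanh (beta * m0 + h) ->
  exists2 C : R, 0 <= C & forall (n : nat) (j : int), (0 < n)%N ->
    `|law_shifted n beta h j - TP_pmf (n%:R * m0 / 2)
        (n%:R * (1 - m0 ^+ 2) / (4 * (1 - beta + beta * m0 ^+ 2))) j| <= C / n%:R.
Proof.
move=> be m0E; have [C C0 loc] := cw_poisson_loc R beta h m0 be m0E.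
exists C => // n j n0.
pose mu : R := n%:R * m0 / 2.
pose s2 : R := n%:R * (1 - m0 ^+ 2) / (4 * (1 - beta + beta * m0 ^+ 2)).
pose a := Num.floor (mu - s2); pose lam : R := s2 + (mu - s2 - a%:~R).
have fl : a%:~R <= mu - s2 := floor_le _.
have fg : mu - s2 < (a + 1)%:~R := floorD1_gt _.
rewrite intrD in fg.
have [loc1 loc2] : (forall i : nat, `|\sum_(K < n.+1) cw_plus n beta h K *
     (K%:Z + (- a - n./2%:Z) == i%:Z)%:R - pois lam i| <= C / n%:R) /\
    (forall K : nat, K%:Z + (- a - n./2%:Z) < 0 -> cw_plus n beta h K <= C / n%:R).
  apply: loc => //; first by rewrite mulrA -/s2 /lam; lra.
  by rewrite delta_half rmorphB rmorphN /= -pmulrn /lam /mu; field.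
rewrite /TP_pmf -/mu -/s2 -/a -/lam; case: ifP => ja.
  have jE : j - a = `|(j - a)%R|%N%:Z by rewrite gez0_abs.
  have E (K : nat) : (K%:Z - n./2%:Z == j) = (K%:Z + (- a - n./2%:Z) == j - a).
    by apply/eqP/eqP; lia.
  rewrite law_shifted_sum; under eq_bigr do rewrite E.
  by have := loc1 `|(j - a)%R|%N; rewrite -jE.
rewrite subr0 ger0_norm ?law_shifted_ge0 //.
have [j0|j0] := ltP (j + n./2%:Z) 0; first by rewrite law_shifted_lt // divr_ge0.
have jE : j = `|(j + n./2%:Z)%R|%N%:Z - n./2%:Z by rewrite gez0_abs // addrK.
rewrite jE law_shifted_natB loc2 //.
by rewrite gez0_abs // addrCA addrC; lia.
Qed.

Lemma cw_dloc_le (R : realType) (beta h m0 : R) :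
  0 < beta < 1 -> m0 = tanh (beta * m0 + h) ->
  exists2 C : R, 0 <= C & forall n : nat, (0 < n)%N ->
    (dloc (law_shifted n beta h)
          (TP_pmf (n%:R * m0 / 2)
             (n%:R * (1 - m0 ^+ 2) / (4 * (1 - beta + beta * m0 ^+ 2))))
     <= (C / n%:R)%:E)%E.
Proof.
move=> be m0E; have [C C0 loc] := cw_TP_loc R beta h m0 be m0E.
exists C => // n n0; apply: ub_ereal_sup => _ [j _ <-].
by rewrite lee_fin loc.
Qed.

Lemma cw_dTV_le (R : realType) (beta h m0 : R) :
  0 < beta < 1 -> m0 = tanh (beta * m0 + h) ->
  exists2 C : R, 0 <= C & forall n : nat, (0 < n)%N ->
    (dTV (law_shifted n beta h)
         (TP_pmf (n%:R * m0 / 2)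
            (n%:R * (1 - m0 ^+ 2) / (4 * (1 - beta + beta * m0 ^+ 2))))
     <= (C * n%:R `^ (- (1 / 3)))%:E)%E.
Proof.
move=> be m0E; have [C C0 loc] := cw_TP_loc R beta h m0 be m0E.
have m01 : -1 < m0 < 1 by rewrite m0E tanh_gtrN1 tanh_ltr1.
have sg0 := cw_ratio_coef_gt0 R beta m0 be m01.
pose V : R := (4 + 9 / (1 - beta)) / (1 - beta) / 4.
have V0 : 0 <= V.
  have b1 : 0 <= 1 - beta by lra.
  by rewrite /V divr_ge0 // divr_ge0 // addr_ge0 // divr_ge0.
exists (3 * C + V) => [|n n0]; first by rewrite addr_ge0 // mulr_ge0.
have n1 : 1 <= n%:R :> R by rewrite ler1n.
have s20 : 0 < n%:R * (1 - m0 ^+ 2) / (4 * (1 - beta + beta * m0 ^+ 2)).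
  by rewrite -mulrA mulr_gt0 // ltr0n.
set q := TP_pmf _ _.
(* The splitting distance L = t^2 = n^(2/3) balances L / n against n / L^2, both equal to 1 / t. *)
pose t : R := n%:R `^ (1 / 3).
have t3 : n%:R = t ^+ 3.
  rewrite /t -powR_mulrn ?powR_ge0 // -powRrM (_ : 1 / 3 * 3%:R = 1) ?powRr1 //; lra.
have t1 : 1 <= t by rewrite /t -[leLHS](powRr0 n%:R) ler_powR //; lra.
have t0 : 0 < t by lra.
have D0 : 0 <= C / n%:R by rewrite divr_ge0.
have sumV : \sum_(K < n.+1) cw_plus n beta h K * (K%:R - n%:R * (1 + m0) / 2) ^+ 2 <= V * n%:R.
  have H := cw_second_moment R beta h m0 n be m0E n0.
  have -> : V * n%:R = 4^-1 * ((4 + 9 / (1 - beta)) / (1 - beta) * n%:R) by rewrite /V; ring.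
  rewrite (eq_bigr (fun K : 'I_n.+1 => 4^-1 *
    (cw_plus n beta h K * (2 * K%:R - n%:R - n%:R * m0) ^+ 2))) => [|K _]; last by field.
  by rewrite -mulr_sumr ler_pM2l.
have t20 : 0 < t ^+ 2 by rewrite exprn_gt0.
have S := sum_min_le R n (cw_plus n beta h) _ _ _ _ (cw_plus_ge0 R n beta h) D0 t20 sumV.
have {}S : \sum_(K < n.+1) Num.min (cw_plus n beta h K) (C / n%:R) <= (3 * C + V) / t.
  apply: le_trans S _; rewrite t3.
  have -> : (2 * t ^+ 2 + 1) * (C / t ^+ 3) + V * t ^+ 3 / (t ^+ 2) ^+ 2 =
    ((2 + (t ^+ 2)^-1) * C + V) / t by field; rewrite gt_eqF.
  rewrite ler_pM2r ?invr_gt0 // lerD2r ler_wpM2r //.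
  have : (t ^+ 2)^-1 <= 1 by rewrite invf_le1 // exprn_ege1.
  by lra.
have min0 : Num.min 0 (C / n%:R) = 0 by apply: min_idPl.
have mins y : 0 <= y -> 0 <= Num.min y (C / n%:R) by move=> y0; rewrite le_min y0.
have H := esum_dist_le R (law_shifted n beta h) q (C / n%:R)
  (law_shifted_ge0 R n beta h) (fun j => TP_pmf_ge0 R _ _ j s20) (fun j => loc n j n0)
  _ (esum_TP_pmf R _ _ s20).
have {}H := H (etrans (esum_law_shifted R n beta h id erefl (fun y y0 => y0))
  (congr1 EFin (sum_cw_plus R n beta h))).
rewrite (esum_law_shifted R n beta h (fun y => Num.min y (C / n%:R)) min0 mins) in H.
(* The factor 1/2 in [dTV] cancels against the two equal sums in [H]. *)
rewrite /dTV; apply: (le_trans (lee_wpmul2l _ H)); first by rewrite lee_fin.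
rewrite -EFinD -EFinM lee_fin powRN -/t; lra.
Qed.

Theorem theorem10 (R : realType) :
  (forall beta : R, 0 < beta < 1 ->
    exists C : R, forall n : nat, (1 <= n)%N ->
      (dloc (law_shifted n beta 0) (TP_pmf 0 (n%:R / (4 * (1 - beta))))
         <= (C * n%:R `^ (- (3 / 4)))%:E)%E /\
      (dTV (law_shifted n beta 0) (TP_pmf 0 (n%:R / (4 * (1 - beta))))
         <= (C * n%:R `^ (- (1 / 3)))%:E)%E)
  /\
  (forall beta h m0 : R, 0 < beta < 1 -> m0 = tanh (beta * m0 + h) ->
    forall eps : R, 0 < eps -> exists N : nat, forall n : nat, (N <= n)%N ->
      (dloc (law_shifted n beta h)
            (TP_pmf (n%:R * m0 / 2)
                    (n%:R * (1 - m0 ^+ 2) / (4 * (1 - beta + beta * m0 ^+ 2))))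
         <= (eps * n%:R `^ (- (1 / 2)))%:E)%E).
Proof.
split=> [beta be|beta h m0 be m0E eps eps0].
  (* Without a field m0 = 0 is a fixed point, and the parameters reduce to 0 and n / (4 (1 -
     beta)). *)
  have m0E : 0 = tanh (beta * 0 + 0) :> R.
    by rewrite mulr0 addr0 /tanh oppr0 subrr mul0r.
  have [C1 C10 loc] := cw_dloc_le R beta 0 0 be m0E.
  have [C2 C20 tv] := cw_dTV_le R beta 0 0 be m0E.
  exists (C1 + C2) => n n0; move: (loc n n0) (tv n n0).
  rewrite mulr0 mul0r expr0n /= subr0 mulr1 mulr0 addr0 => {}loc {}tv.
  have n1 : 1 <= n%:R :> R by rewrite ler1n.
  split.
    apply: le_trans loc _; rewrite lee_fin ler_pM ?invr_ge0 ?lerDl //.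
    by rewrite -powR_inv1 // ler_powR //; lra.
  by apply: le_trans tv _; rewrite lee_fin ler_wpM2r ?powR_ge0 // lerDr.
have [C C0 loc] := cw_dloc_le R beta h m0 be m0E.
(* For n > (C / eps)^2 the bound C / n is at most eps n^(-1/2). *)
exists (Num.truncn ((C / eps) ^+ 2)).+1 => n Nn.
have n0 : (0 < n)%N by apply: leq_trans Nn.
apply: le_trans (loc n n0) _; rewrite lee_fin powRN.
pose u : R := n%:R `^ (1 / 2); rewrite -/u.
have u2 : n%:R = u ^+ 2.
  rewrite /u -powR_mulrn ?powR_ge0 // -powRrM (_ : 1 / 2 * 2%:R = 1) ?powRr1 //; lra.
have u0 : 0 < u by rewrite powR_gt0 // ltr0n.
have : (C / eps) ^+ 2 < u ^+ 2.
  by rewrite -u2; apply: lt_le_trans (truncnS_gt _) _; rewrite ler_nat.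
rewrite ltr_pXn2r ?nnegrE ?divr_ge0 ?(ltW u0) ?(ltW eps0) // ltr_pdivrMr // => /ltW H.
rewrite u2 expr2 invfM mulrA ler_pM2r ?invr_gt0 // ler_pdivrMr //.
by rewrite mulrC.
Qed.
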